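(* Let $0<\alpha\le1$ and let $B$ be a compact subset of a Hilbert space $H$ with $\overline{\dim}_B B<1/\alpha$. Then $B$ can be covered by an $\alpha$-Hölder image of $[0,1]$; that is, there is an $\alpha$-Hölder map $g\colon[0,1]\to H$ with $B\subset g([0,1])$.
   Context: For a compact metric space $X$ and $r>0$ let $N(X,r)$ be the minimal number of closed balls of radius $r$ (centered in $X$) that cover $X$; the upper box dimension is $\overline{\dim}_B X=\limsup_{r\to0+}\frac{\log N(X,r)}{\log(1/r)}\in[0,\infty]$ for nonempty $X$ (and $0$ for the empty set). A map $f$ between metric spaces is $\alpha$-Hölder if there is a finite $C$ with $d_Y(f(x),f(z))\le C\,d_X(x,z)^\alpha$ for all $x,z$ in its domain. *)

(* Defs.v *)
From HB Require Import structures.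
From mathcomp Require Import all_boot all_order all_algebra.
From mathcomp Require Import all_classical all_reals all_analysis.
From mathcomp Require Import complex.

Set Implicit Arguments.
Unset Strict Implicit.
Unset Printing Implicit Defensive.

Import Order.TTheory GRing.Theory Num.Theory.
Import numFieldNormedType.Exports.

Local Open Scope classical_set_scope.
Local Open Scope ring_scope.

(* A Hilbert space may be real or complex: the scalar field is R or R[i].
   Norms then take values in that field, where they are nonnegative reals, so
   distances are brought back to R by [scalar_re], which loses nothing. *)
Variant scalar_kind := RealScalars | ComplexScalars.

Definition scalar_field (R : realType) (k : scalar_kind) : numFieldType :=
  match k with
  | RealScalars => R
  | ComplexScalars => complex R
  end.

Definition scalar_conj (R : realType) (k : scalar_kind) :
    scalar_field R k -> scalar_field R k :=
  match k with
  | RealScalars => fun x => x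
  | ComplexScalars => fun z => conjc z
  end.

Definition scalar_re (R : realType) (k : scalar_kind) : scalar_field R k -> R :=
  match k with
  | RealScalars => fun x => x
  | ComplexScalars => fun z => complex.Re z
  end.

Record hilbertSpace (R : realType) (k : scalar_kind) := HilbertSpace {
  hilbert_sort :> completeNormedModType (scalar_field R k) ;
  hilbert_dot : {dot hilbert_sort for @scalar_conj R k} ;
  hilbert_normE : forall x : hilbert_sort, `|x| ^+ 2 = hilbert_dot x x
}.

Definition hilbert_dist (R : realType) (k : scalar_kind)
    (H : hilbertSpace R k) (x y : H) : R :=
  scalar_re `|x - y|.

Section box_dimension.
Variables (R : realType) (T : Type) (dist : T -> T -> R).

(* The balls are centered in X; there are at most n of them since c need not
   be injective, which does not affect the minimum. *)
Definition covered_by_balls (X : set T) (r : R) (n : nat) : Prop :=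
  exists c : 'I_n -> T,
    (forall i, X (c i)) /\ (forall x, X x -> exists i, dist (c i) x <= r).

(* The infimum over a nonempty set of naturals is attained; it is +oo when
   there is no finite cover, which does not occur for compact X and r > 0. *)
Definition covering_number (X : set T) (r : R) : \bar R :=
  ereal_inf [set (n%:R)%:E | n in [set n | covered_by_balls X r n]].

Definition upper_box_dim (X : set T) : \bar R :=
  if `[< X = set0 >] then 0%E
  else limf_esup
         (fun r : R => (lne (covering_number X r) * ((ln r^-1)^-1)%:E)%E) 0^'+.

End box_dimension.

Definition holder_on (R : realType) (S T : Type) (dS : S -> S -> R)
    (dT : T -> T -> R) (alpha : R) (D : set S) (f : S -> T) : Prop :=
  exists C : R, forall x z, D x -> D z -> dT (f x) (f z) <= C * dS x z `^ alpha.

(* Main.v *)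
Require Import Defs.
From mathcomp Require Import all_boot all_order all_algebra.
From mathcomp Require Import all_classical all_reals all_analysis.
From mathcomp Require Import complex ring lra.

(* Choose s with dim B < s < 1/alpha and nets E_n of B at scales ~ 2^-n with at
   most C 2^(ns) points. Attach each point of E_(n+1) to a nearby point of E_n;
   sorting every level by the index of the parent gives an ordered tree. An
   infinite branch a (the sequence of its node indices) is placed at the time
   sum_n delta_n a_n, with delta_n ~ 2^(-nb) and s < b < 1/alpha, so the series
   converges. The order makes branches that differ at level n lie delta_n apart
   in time. Hence g can be written as a sum over n of maps that take the value
   (level n+1 point) - (level n point) near the times of the branches through
   the given node, and interpolate to 0 elsewhere: the n-th map has sup norm
   ~ 2^-n and Lipschitz constant ~ 2^-n / delta_n, hence alpha-Hoelder constant
   ~ 2^-n delta_n^-alpha, which is summable because b alpha < 1. The image of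
   [0,1] is compact and contains every net, hence B. *)

Set Implicit Arguments.
Unset Strict Implicit.
Unset Printing Implicit Defensive.

Import Order.TTheory GRing.Theory Num.Theory.
Import numFieldNormedType.Exports.

Local Open Scope classical_set_scope.
Local Open Scope ring_scope.

(** * Real scalars inside the real or complex field, and the norm read as a real number *)

Definition scalar_of_real (R : realType) (k : scalar_kind) :
    R -> scalar_field R k :=
  match k with
  | RealScalars => fun c => c
  | ComplexScalars => fun c => real_complex R c
  end.

Definition hilbert_norm (R : realType) (k : scalar_kind) (H : hilbertSpace R k)
    (x : H) : R :=
  scalar_re `|x|.

Section real_scalars.
Context {R : realType} {k : scalar_kind}.
Implicit Types (a c : R) (x y : scalar_field R k).

Lemma scalar_reD x y : scalar_re (x + y) = scalar_re x + scalar_re y.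
Proof. by case: k x y => //= -[a b] [c d]. Qed.

Lemma scalar_re0 : scalar_re (0 : scalar_field R k) = 0.
Proof. by case: k. Qed.

Lemma scalar_re_le x y : x <= y -> scalar_re x <= scalar_re y.
Proof. by case: k x y => //= x y; rewrite lecE => /andP[]. Qed.

Lemma scalar_re_lt x y : 0 <= x -> 0 <= y -> (scalar_re x < scalar_re y) = (x < y).
Proof.
case: k x y => //= -[a b] [c d]; rewrite !lecE ltcE /=.
by move=> /andP[/eqP-> _] /andP[/eqP-> _]; rewrite eqxx.
Qed.

Lemma scalar_of_realK c : scalar_re (scalar_of_real k c) = c.
Proof. by case: k. Qed.

Lemma scalar_reK x : 0 <= x -> scalar_of_real k (scalar_re x) = x.
Proof.
case: k x => //= -[a b]; rewrite lecE /= => /andP[/eqP b0 _].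
by rewrite b0.
Qed.

Lemma scalar_of_realB a c :
  scalar_of_real k (a - c) = scalar_of_real k a - scalar_of_real k c.
Proof. by case: k => //=; rewrite rmorphB. Qed.

Lemma scalar_of_real0 : scalar_of_real k (0 : R) = 0.
Proof. by case: k. Qed.

Lemma scalar_of_real1 : scalar_of_real k (1 : R) = 1.
Proof. by case: k. Qed.

Lemma scalar_re_normM c x :
  scalar_re (`|scalar_of_real k c| * x) = `|c| * scalar_re x.
Proof.
case: k x => //= -[a b]; rewrite /Num.norm /= expr0n addr0 sqrtr_sqr /=.
by rewrite mul0r subr0.
Qed.

End real_scalars.

(** * The real-valued norm and completeness *)

Section hilbert_norm_theory.
Context {R : realType} {k : scalar_kind} {H : hilbertSpace R k}.
Implicit Types (x y : H) (c : R).

Lemma hilbert_norm0 : hilbert_norm (0 : H) = 0.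
Proof. by rewrite /hilbert_norm normr0 scalar_re0. Qed.

Lemma hilbert_norm_ge0 x : 0 <= hilbert_norm x.
Proof. by rewrite -(@scalar_re0 R k); apply: scalar_re_le. Qed.

Lemma hilbert_normD x y :
  hilbert_norm (x + y) <= hilbert_norm x + hilbert_norm y.
Proof. by rewrite -scalar_reD; apply/scalar_re_le/ler_normD. Qed.

Lemma hilbert_norm_distC x y : hilbert_norm (x - y) = hilbert_norm (y - x).
Proof. by rewrite /hilbert_norm distrC. Qed.

Lemma hilbert_dist_triangle z x y :
  hilbert_norm (x - y) <= hilbert_norm (x - z) + hilbert_norm (z - y).
Proof. by rewrite -[in leLHS](subrK z x) -addrA hilbert_normD. Qed.

Lemma hilbert_norm_eq0 x : hilbert_norm x = 0 -> x = 0.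
Proof.
move=> x0; apply/normr0_eq0; rewrite -[LHS]scalar_reK //.
by rewrite -/(hilbert_norm x) x0 scalar_of_real0.
Qed.

Lemma hilbert_normZ c x :
  hilbert_norm (scalar_of_real k c *: x) = `|c| * hilbert_norm x.
Proof. by rewrite /hilbert_norm normrZ scalar_re_normM. Qed.

Lemma hilbert_norm_sum (I : Type) (s : seq I) (P : pred I) (F : I -> H) :
  hilbert_norm (\sum_(i <- s | P i) F i) <= \sum_(i <- s | P i) hilbert_norm (F i).
Proof.
elim/big_ind2 : _ => [|x1 x2 y1 y2 h1 h2|//]; first by rewrite hilbert_norm0.
by apply: le_trans (hilbert_normD _ _) _; apply: lerD.
Qed.

(** The series of [b] is nondecreasing and bounded, so its tails tend to 0; they dominate the
    distances between later terms of [u], which is therefore Cauchy. *)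
Lemma summable_steps_cvg (u : nat -> H) (b : nat -> R) (M : R) :
  (forall n, hilbert_norm (u n.+1 - u n) <= b n) ->
  (forall n, \sum_(i < n) b i <= M) ->
  exists l, hilbert_norm (u n - l) @[n --> \oo] --> 0.
Proof.
move=> ub bM.
have b0 n : 0 <= b n by apply: le_trans (ub n); apply: hilbert_norm_ge0.
have cb : cvgn (series b).
  apply: nondecreasing_is_cvgn => [|]; last first.
    by exists M => _ [n _ <-]; rewrite seriesEord; exact: bM.
  by apply/nondecreasing_seqP => n; rewrite seriesSr lerDl.
have step m n : (m <= n)%N ->
    hilbert_norm (u n - u m) <= series b n - series b m.
  move=> /subnK <-; elim: (n - m)%N => [|p IH].
    by rewrite !subrr hilbert_norm0.
  apply: le_trans (hilbert_dist_triangle (u (p + m)%N) _ _) _.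
  rewrite addSn seriesSr [leRHS]addrAC [leRHS]addrC; exact: lerD.
have L n : series b n <= limn (series b).
  apply: nondecreasing_cvgn_le => //; apply/nondecreasing_seqP => j.
  by rewrite seriesSr lerDl.
have cu : cvg ((u : nat -> hilbert_sort H) n @[n --> \oo]).
  (* A positive scalar [e] is real even over the complex field, so comparing real parts suffices. *)
  apply/cauchy_cvgP/cauchy_exP => e e0.
  have re0 : 0 < scalar_re e by rewrite -(@scalar_re0 R k) scalar_re_lt ?(ltW e0).
  move/cvgrPdist_lt/(_ _ re0) : (cb) => [m _ /(_ m (leqnn m))] /=.
  rewrite ger0_norm ?subr_ge0// => Lm.
  exists (u m); exists m => // n mn; rewrite -ball_normE /=.
  rewrite -scalar_re_lt ?(ltW e0)// -/(hilbert_norm _) hilbert_norm_distC.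
  apply: le_lt_trans (step _ _ mn) (le_lt_trans _ Lm).
  by rewrite lerD2r.
exists (lim (u n @[n --> \oo])); apply/cvgrPdist_lt => e e0.
have e0' : 0 < scalar_of_real k e.
  by case: (k) => //=; rewrite ltcE /= eqxx.
move/cvgrPdist_lt/(_ _ e0') : cu; apply: filterS => n.
rewrite -scalar_re_lt ?(ltW e0')// scalar_of_realK distrC => h.
by rewrite sub0r normrN ger0_norm ?hilbert_norm_ge0.
Qed.

End hilbert_norm_theory.

(** * Tent functions: bumps equal to 1 on a set and vanishing at distance [e] from it *)

Section tent.
Context {R : realType}.
Implicit Types (I : set R) (e s t : R).

(** This is max(0, 1 - dist(t, I) / e), written as a supremum of cones. Adjoining 0 keeps the
    supremum over a nonempty set when [I] is empty. *)
Definition tent I e t : R :=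
  sup ([set Num.max 0 (1 - `|t - u| / e) | u in I] `|` [set 0]).

Variables (I : set R) (e : R).
Hypothesis e_gt0 : 0 < e.

Lemma tent_has_sup t :
  has_sup ([set Num.max 0 (1 - `|t - u| / e) | u in I] `|` [set 0]).
Proof.
split; first by exists 0; right.
exists 1 => _ [[u _ <-]|->//]; rewrite ge_max ler01 /= gerBl.
by rewrite divr_ge0 // ltW.
Qed.

Lemma tent_ge0 t : 0 <= tent I e t.
Proof. by apply: ub_le_sup; [case: (tent_has_sup t)|right]. Qed.

Lemma tent_le1 t : tent I e t <= 1.
Proof.
apply: ge_sup; first by case: (tent_has_sup t).
move=> _ [[u _ <-]|->//]; rewrite ge_max ler01 /= gerBl.
by rewrite divr_ge0 // ltW.
Qed.

Lemma tent_in t : I t -> tent I e t = 1.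
Proof.
move=> It; apply/eqP; rewrite eq_le tent_le1 /=.
apply: ub_le_sup; first by case: (tent_has_sup t).
left; exists t => //; rewrite subrr normr0 mul0r subr0.
by apply/max_idPr.
Qed.

Lemma tent_out t : (forall u, I u -> e <= `|t - u|) -> tent I e t = 0.
Proof.
move=> far; apply/eqP; rewrite eq_le tent_ge0 andbT.
apply: ge_sup; first by case: (tent_has_sup t).
move=> _ [[u /far tu <-]|->//]; rewrite ge_max lexx /= subr_le0.
by rewrite ler_pdivlMr // mul1r.
Qed.

Lemma tent_lipschitz t s : `|tent I e t - tent I e s| <= `|t - s| / e.
Proof.
wlog : s t / tent I e s <= tent I e t.
  move=> h; have [/h//|/ltW/h] := leP (tent I e s) (tent I e t).
  by rewrite distrC (distrC s).
move=> st; rewrite ger0_norm ?subr_ge0 // lerBlDr.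
have d0 : 0 <= `|t - s| / e by rewrite divr_ge0 // ltW.
apply: ge_sup; first by case: (tent_has_sup t).
move=> _ [[u Iu <-]|->]; last by rewrite addr_ge0 // tent_ge0.
rewrite ge_max addr_ge0 ?tent_ge0 //=.
have : Num.max 0 (1 - `|s - u| / e) <= tent I e s.
  by apply: ub_le_sup; [case: (tent_has_sup s)|left; exists u].
rewrite ge_max => /andP[_ su].
have : `|s - u| / e <= `|t - s| / e + `|t - u| / e.
  by rewrite -mulrDl ler_pM2r ?invr_gt0// (distrC t s) ler_distD.
lra.
Qed.

(** The difference lies in [0, 1], where y <= y^alpha; the Lipschitz bound is then raised to the
    power [alpha]. *)
Lemma tent_holder (alpha : R) t s : 0 < alpha -> alpha <= 1 ->
  `|tent I e t - tent I e s| <= (`|t - s| / e) `^ alpha.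
Proof.
move=> a0 a1; set y := `|tent I e t - tent I e s|.
have y1 : y <= 1.
  by rewrite /y ler_norml; have := tent_ge0 t; have := tent_ge0 s;
     have := tent_le1 t; have := tent_le1 s; lra.
apply: (@le_trans _ _ (y `^ alpha)); last first.
  apply: ge0_ler_powR; rewrite ?nnegrE ?normr_ge0 ?(ltW a0)//.
    by rewrite divr_ge0 // ltW.
  exact: tent_lipschitz.
have [->|y0] := eqVneq y 0; first exact: powR_ge0.
rewrite -[leLHS]powRr1 ?normr_ge0 //; apply: ger_powR => //.
by rewrite lt_neqAle eq_sym y0 normr_ge0.
Qed.

End tent.

Lemma sum_unique_support_le (R : realType) (n : nat) (x : 'I_n -> R) (c : R) :
  0 <= c -> (forall i j, x i != 0 -> x j != 0 -> i = j) ->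
  \sum_(i < n) c * (x i != 0)%:R <= c.
Proof.
move=> c0 uniq_supp; rewrite -mulr_sumr -natr_sum ler_piMr //.
have -> : (\sum_(i < n) (x i != 0%R) = #|[pred i | x i != 0%R]|)%N.
  rewrite -sum1_card [RHS]big_mkcond; apply: eq_bigr => i _.
  by rewrite inE; case: (_ != _).
rewrite lern1.
by apply/card_le1_eqP => i j; rewrite !inE => xi xj; apply: uniq_supp.
Qed.

(** * The Hölder map attached to an ordered tree of points *)

Section ordered_tree.
Context {R : realType} {k : scalar_kind} {H : hilbertSpace R k}.
Variables (alpha : R) (N : nat -> nat) (par : nat -> nat -> nat).
Variables (p : nat -> nat -> H) (r delta : nat -> R) (M : R).

Hypothesis alpha_gt0 : 0 < alpha.
Hypothesis alpha_le1 : alpha <= 1.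
Hypothesis N0 : N 0 = 1%N.
Hypothesis par_lt : forall n j, (j < N n.+1)%N -> (par n j < N n)%N.
Hypothesis par_homo : forall n i j,
  (i <= j)%N -> (j < N n.+1)%N -> (par n i <= par n j)%N.
Hypothesis p_step : forall n j, (j < N n.+1)%N ->
  hilbert_norm (p n.+1 j - p n (par n j)) <= r n.
Hypothesis p_lift : forall n i, (i < N n)%N ->
  exists j, [/\ (j < N n.+1)%N, par n j = i & p n.+1 j = p n i].
Hypothesis delta_gt0 : forall n, 0 < delta n.
Hypothesis sum_delta : forall n, \sum_(i < n) delta i * (N i)%:R <= 1.
Hypothesis sum_r : forall n, \sum_(i < n) r i <= M.
Hypothesis sum_holder : forall n,
  \sum_(i < n) r i * ((delta i.+1 / 2)^-1) `^ alpha <= M.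

Lemma level_gt0 n : (0 < N n)%N.
Proof.
elim: n => [|n IH]; first by rewrite N0.
by have [j []] := p_lift IH; case: (N n.+1).
Qed.

Lemma r_ge0 n : 0 <= r n.
Proof. by apply: le_trans (p_step (level_gt0 n.+1)); exact: hilbert_norm_ge0. Qed.

Definition branch (a : nat -> nat) : Prop :=
  forall n, (a n < N n)%N /\ par n (a n.+1) = a n.

(** Branches do not cross: the monotone parent map carries weak inequalities down the levels, and by
    contraposition strict ones up. *)
Lemma branch_le a b n : branch a -> branch b -> (a n < b n)%N ->
  forall m, (a m <= b m)%N.
Proof.
move=> ba bb ab m; have down i j : (a (i + j) <= b (i + j) -> a j <= b j)%N.
  elim: i => // i IH le_ab; apply: IH.
  rewrite -(ba (i + j)%N).2 -(bb (i + j)%N).2; apply: par_homo => //.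
  exact: (bb _).1.
have up i j : (a j < b j -> a (i + j) < b (i + j))%N.
  move=> lt_ab; elim: i => // i; rewrite !ltnNge; apply: contraNN => le_ba.
  rewrite -(ba (i + j)%N).2 -(bb (i + j)%N).2; apply: par_homo => //.
  exact: (ba _).1.
have [mn|/ltnW nm] := leqP m n; last by rewrite -(subnK nm) ltnW// up.
by apply: (down (n - m)%N); rewrite subnK // ltnW.
Qed.

(** The levels below [m] are filled in by taking parents, one level per induction step. *)
Lemma branch_extend m a :
  (forall n, (m <= n)%N -> (a n < N n)%N /\ par n (a n.+1) = a n) ->
  exists b, branch b /\ forall n, (m <= n)%N -> b n = a n.
Proof.
elim: m a => [|m IH] a ha; first by exists a; split => // n; exact: ha.
pose c n := if n == m then par m (a m.+1) else a n.
have [n|b [bb bc]] := IH c.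
  rewrite leq_eqVlt /c => /predU1P[<-|mn].
    by rewrite eqxx gtn_eqF //; split => //; apply: par_lt; apply: (ha _ _).1.
  by rewrite !gtn_eqF ?(ltnW mn) //; [exact: ha|rewrite ltnW].
by exists b; split => // n mn; rewrite bc ?(ltnW mn)// /c gtn_eqF.
Qed.

(** Following children that repeat the point makes the branch eventually constant in [H]; this is
    why each node's point is attained exactly and not only approximated. *)
Lemma branch_through m i : (i < N m)%N ->
  exists a, branch a /\ forall n, (m <= n)%N -> p n (a n) = p m i.
Proof.
move=> im.
(* [f] picks a child carrying the same point; outside the tree its value is arbitrary. *)
have /choice[f fP] : forall nj : nat * nat, exists j', (nj.2 < N nj.1)%N ->
    [/\ (j' < N nj.1.+1)%N, par nj.1 j' = nj.2 & p nj.1.+1 j' = p nj.1 nj.2].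
  move=> [n j] /=; have [/p_lift[j' ?]|_] := ltnP j (N n); first by exists j'.
  by exists 0%N.
pose a := fix a d := if d is d'.+1 then f ((m + d')%N, a d') else i.
have aP d : (a d < N (m + d))%N /\ p (m + d)%N (a d) = p m i.
  elim: d => [|d [lt_a pa]]; first by rewrite addn0.
  by have [] := fP (_, _) lt_a; rewrite addnS /= pa.
have [n mn|b [bb ba]] := @branch_extend m (fun n => a (n - m)%N).
  have [] := aP (n - m)%N; rewrite subnKC // subSn //= => lt_a _.
  by have [] := fP (_, _) lt_a; rewrite /= subnKC.
exists b; split => // n mn; rewrite ba //.
by have [_] := aP (n - m)%N; rewrite subnKC.
Qed.

Definition time (a : nat -> nat) : R :=
  limn (series (fun n => delta n * (a n)%:R)).

Lemma time_bounds a : branch a ->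
  [/\ cvgn (series (fun n => delta n * (a n)%:R)), 0 <= time a & time a <= 1].
Proof.
move=> ba; set u := (fun n => _).
have u0 n : 0 <= u n by rewrite mulr_ge0// ltW.
have s1 n : series u n <= 1.
  rewrite seriesEord /=; apply: le_trans (sum_delta n); apply: ler_sum => i _.
  by rewrite ler_pM2l // ler_nat ltnW // (ba _).1.
have cu : cvgn (series u).
  apply: nondecreasing_is_cvgn; last by exists 1 => _ [n _ <-]; exact: s1.
  by apply/nondecreasing_seqP => n; rewrite seriesSr lerDl.
split => //.
  apply: limr_ge => //; apply: nearW => n; rewrite seriesEord.
  by apply: sumr_ge0 => i _; apply: u0.
rewrite /time -/u; apply: limr_le => //; exact: nearW.
Qed.

(** By [branch_le] every term of the series for the difference is nonnegative, and the term of index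
    [n] alone is at least [delta n]. *)
Lemma time_separated a b n : branch a -> branch b -> (a n < b n)%N ->
  delta n <= time b - time a.
Proof.
move=> ba bb ab; have [ca _ _] := time_bounds ba.
have [cb _ _] := time_bounds bb.
rewrite /time -limB //; apply: limr_ge; first exact: is_cvgB.
exists n.+1 => // m /= nm; rewrite !fctE !seriesEord /= -sumrB.
rewrite (bigD1 (Ordinal nm)) //= -mulrBr; apply: ler_wpDr.
  apply: sumr_ge0 => i _; rewrite -mulrBr mulr_ge0 ?(ltW (delta_gt0 _)) //.
  rewrite subr_ge0 ler_nat.
  exact: branch_le ab _.
by rewrite ler_peMr ?(ltW (delta_gt0 n)) // lerBrDr nat1r ler_nat.
Qed.

Definition times n j : set R := [set time a | a in [set a | branch a /\ a n = j]].

Definition weight n j (t : R) : R := tent (times n j) (delta n / 2) t.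

Let half_gt0 n : 0 < delta n / 2.
Proof. by rewrite divr_gt0. Qed.

(** Tents have radius [delta n / 2], so two of them active at the same [t] would give branch times
    less than [delta n] apart, against [time_separated]. *)
Lemma weight_unique n t i j : weight n i t != 0 -> weight n j t != 0 -> i = j.
Proof.
have near_times l : weight n l t != 0 ->
    exists a, [/\ branch a, a n = l & `|t - time a| < delta n / 2].
  apply: contra_neqP => far; apply: tent_out => // _ [a [ba al] <-].
  by rewrite leNgt; apply/negP => lt_a; apply: far; exists a.
move=> /near_times[a [ba <- ta]] /near_times[b [bb <- tb]].
have ab : `|time a - time b| < delta n.
  rewrite (splitr (delta n)) (le_lt_trans (ler_distD t _ _)) //.
  by rewrite (distrC _ t) ltrD.
case: (ltngtP (a n) (b n)) => // [/(time_separated ba bb)|/(time_separated bb ba)] h.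
  by move: ab; rewrite distrC ltNge (le_trans h (ler_norm _)).
by move: ab; rewrite ltNge (le_trans h (ler_norm _)).
Qed.

Lemma weight_time n a j : branch a -> weight n j (time a) = (j == a n)%:R.
Proof.
move=> ba; have w1 : weight n (a n) (time a) = 1.
  by apply: tent_in => //; exists a.
have [->//|] := eqVneq; apply: contra_neqP => /eqP w0.
by apply: (@weight_unique n (time a)) => //; rewrite w1 oner_eq0.
Qed.

Definition increment n (t : R) : H :=
  \sum_(j < N n.+1) scalar_of_real k (weight n.+1 j t) *:
    (p n.+1 j - p n (par n j)).

(** At each [t] at most one summand is nonzero, so the number of nodes does not enter the bound. *)
Lemma increment_le n t : hilbert_norm (increment n t) <= r n.
Proof.
apply: le_trans (hilbert_norm_sum _ _ _) _.
apply: (@le_trans _ _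
    (\sum_(j < N n.+1) r n * (weight n.+1 j t != 0)%:R)).
  apply: ler_sum => j _; rewrite hilbert_normZ.
  have [->|w0] := eqVneq; first by rewrite normr0 mul0r mulr0.
  rewrite mulr1 ger0_norm ?tent_ge0 //.
  apply: le_trans (p_step (ltn_ord j)); rewrite ler_piMl ?hilbert_norm_ge0 //.
  exact: tent_le1.
apply: (@sum_unique_support_le _ _ (fun j => weight n.+1 j t)) => // [|i j wi wj].
  exact: r_ge0.
by apply/val_inj/(weight_unique wi wj).
Qed.

Lemma increment_holder n t s :
  hilbert_norm (increment n t - increment n s) <=
    2 * `|t - s| `^ alpha * (r n * ((delta n.+1 / 2)^-1) `^ alpha).
Proof.
set c := `|t - s| `^ alpha * (r n * ((delta n.+1 / 2)^-1) `^ alpha).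
have c0 : 0 <= c by rewrite !mulr_ge0 ?powR_ge0 ?r_ge0.
(* The factor 2 counts the active nodes: at most one at [t] and at most one at [s], each charged
   [c]. *)
rewrite -mulrA -/c (_ : 2 * c = c + c); last by ring.
have supp u : \sum_(j < N n.+1) c * (weight n.+1 j u != 0)%:R <= c.
  apply: (@sum_unique_support_le _ _ (fun j => weight n.+1 j u)) => // i j wi wj.
  by apply/val_inj/(weight_unique wi wj).
apply: le_trans (lerD (supp t) (supp s)); rewrite -big_split /= -sumrB.
apply: le_trans (hilbert_norm_sum _ _ _) _; apply: ler_sum => j _.
rewrite -scalerBl -scalar_of_realB hilbert_normZ -mulrDr.
have [/andP[/eqP-> /eqP->]|] := boolP ((weight n.+1 j t == 0) && (weight n.+1 j s == 0)).
  by rewrite subrr normr0 mul0r mulr_ge0 // addr_ge0.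
rewrite negb_and => ts0; apply: (@le_trans _ _ c); last first.
  by rewrite ler_peMr // -natrD ler1n addn_gt0 !lt0b.
have -> : c = (`|t - s| / (delta n.+1 / 2)) `^ alpha * r n.
  by rewrite powRM ?invr_ge0 ?(ltW (half_gt0 _)) // /c mulrA mulrAC.
apply: ler_pM; rewrite ?normr_ge0 ?hilbert_norm_ge0 ?p_step //.
exact: tent_holder.
Qed.

Lemma increment_time n a : branch a ->
  increment n (time a) = p n.+1 (a n.+1) - p n (a n).
Proof.
move=> ba; rewrite /increment (bigD1 (Ordinal (ba n.+1).1)) //= big1 => [|j ja].
  by rewrite weight_time // eqxx scalar_of_real1 scale1r addr0 (ba n).2.
rewrite weight_time // (_ : (j == _ :> nat) = false) ?scalar_of_real0 ?scale0r //.
by apply: contraNF ja => /eqP ja; apply/eqP/val_inj.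
Qed.

Definition partial_map n (t : R) : H := p 0 0 + \sum_(i < n) increment i t.

(** At a branch time the increments telescope along the branch. *)
Lemma partial_map_time n a : branch a -> partial_map n (time a) = p n (a n).
Proof.
move=> ba; elim: n => [|n IH].
  rewrite /partial_map big_ord0 addr0; have := (ba 0%N).1.
  by rewrite N0 ltnS leqn0 => /eqP->.
by rewrite /partial_map big_ord_recr /= addrA -/(partial_map n _) IH
  increment_time // addrC subrK.
Qed.

Lemma partial_map_holder n t s :
  hilbert_norm (partial_map n t - partial_map n s) <= 2 * M * `|t - s| `^ alpha.
Proof.
rewrite /partial_map opprD addrACA subrr add0r -sumrB.
apply: le_trans (hilbert_norm_sum _ _ _) _.
apply: (@le_trans _ _ (\sum_(i < n)
    2 * `|t - s| `^ alpha * (r i * ((delta i.+1 / 2)^-1) `^ alpha))).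
  by apply: ler_sum => i _; exact: increment_holder.
by rewrite -mulr_sumr [leRHS]mulrAC ler_wpM2l // mulr_ge0 // powR_ge0.
Qed.

Lemma holder_map_through_tree :
  exists g : R -> H,
    (forall t s, hilbert_norm (g t - g s) <= 2 * M * `|t - s| `^ alpha) /\
    forall n i, (i < N n)%N -> exists t, [/\ 0 <= t, t <= 1 & g t = p n i].
Proof.
have /choice[g gP] : forall t, exists l,
    hilbert_norm (partial_map n t - l) @[n --> \oo] --> (0 : R).
  move=> t; apply: (summable_steps_cvg (b := r)) sum_r => n.
  rewrite /partial_map big_ord_recr /= addrA [X in hilbert_norm X]addrAC subrr add0r.
  exact: increment_le.
have dist_cvg (u : nat -> H) l : hilbert_norm (u n - l) @[n --> \oo] --> (0 : R) ->
  forall e, 0 < e -> exists m, forall n, (m <= n)%N -> hilbert_norm (u n - l) < e.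
  move=> /cvgrPdist_lt ul e /ul[m _ mP]; exists m => n /mP.
  by rewrite sub0r normrN ger0_norm ?hilbert_norm_ge0.
exists g; split => [t s|n i ni].
  apply/ler_addgt0Pl => e e0.
  have e20 : 0 < e / 2 by rewrite divr_gt0.
  have [m mP] := dist_cvg _ _ (gP t) _ e20.
  have [m' mP'] := dist_cvg _ _ (gP s) _ e20.
  have {mP}h := mP _ (leq_maxl m m').
  have {mP'}h' := mP' _ (leq_maxr m m').
  have h2 := partial_map_holder (maxn m m') t s.
  have := hilbert_dist_triangle (partial_map (maxn m m') t) (g t) (g s).
  have := hilbert_dist_triangle (partial_map (maxn m m') s)
    (partial_map (maxn m m') t) (g s).
  rewrite (hilbert_norm_distC (g t) (partial_map _ _)); lra.
(* At the time of this branch the partial maps equal [p n i] from index [n] on, hence so does their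
   limit. *)
have [a [ba pa]] := branch_through ni.
have [_ a0 a1] := time_bounds ba.
exists (time a); split => //; apply/eqP; rewrite eq_sym -subr_eq0; apply/eqP.
apply: hilbert_norm_eq0; apply/eqP; rewrite eq_le hilbert_norm_ge0 andbT.
apply/ler_addgt0Pl => e e0; rewrite addr0.
have [m mP] := dist_cvg _ _ (gP (time a)) _ e0.
have := mP _ (leq_maxl m n); rewrite partial_map_time // pa ?leq_maxr //.
exact: ltW.
Qed.

End ordered_tree.

(** * Building the ordered tree from a sequence of finite nets *)

Section tree_of_nets.
Context {R : realType} {k : scalar_kind} {H : hilbertSpace R k}.
Variables (E : nat -> seq H) (r : nat -> R) (x0 : H).

Hypothesis E0 : E 0 = [:: x0].
Hypothesis r_ge0 : forall n, 0 <= r n.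
Hypothesis E_near : forall n e, e \in E n.+1 ->
  exists2 e', e' \in E n & hilbert_norm (e' - e) <= r n.

(* A node is a pair (index of its parent in the previous level, point). Each
   level repeats the points of the previous one so that every node has a child. *)
Definition next_level n (s : seq (nat * H)) : seq (nat * H) :=
  [seq (i, (nth (0%N, 0) s i).2) | i <- iota 0 (size s)] ++
  [seq (find (fun q => hilbert_norm (q.2 - e) <= r n) s, e) | e <- E n.+1].

(** Sorting by parent index is what makes the parent map monotone. The parent index 0 at the root is
    a dummy. *)
Fixpoint level n : seq (nat * H) :=
  if n is m.+1 then sort (relpre fst leq) (next_level m (level m))
  else [:: (0%N, x0)].

Definition level_parent n j := (nth (0%N, 0) (level n.+1) j).1.
Definition level_point n j := (nth (0%N, 0) (level n) j).2.

(** Repeating the previous level makes the net sizes accumulate. *)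
Lemma size_level n : size (level n) = (\sum_(j < n.+1) size (E j))%N.
Proof.
elim: n => [|n IH]; first by rewrite big_ord_recr big_ord0 /= E0.
by rewrite big_ord_recr /= size_sort size_cat !size_map size_iota IH.
Qed.

Lemma mem_net_level n e : e \in E n ->
  exists2 i, (i < size (level n))%N & level_point n i = e.
Proof.
suff h : e \in E n -> e \in [seq q.2 | q <- level n].
  move=> /h /mapP[q qn ->]; exists (index q (level n)); first by rewrite index_mem.
  by rewrite /level_point nth_index.
case: n => [|n]; first by rewrite E0 /=.
move=> en; apply/mapP.
exists (find (fun q => hilbert_norm (q.2 - e) <= r n) (level n), e) => //=.
rewrite mem_sort mem_cat; apply/orP; right; apply/mapP; by exists e.
Qed.

Lemma level_cases n j : (j < size (level n.+1))%N ->
  (level_parent n j < size (level n))%N /\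
  hilbert_norm (level_point n.+1 j - level_point n (level_parent n j)) <= r n.
Proof.
move=> /(mem_nth (0%N, 0)); rewrite /level_parent /level_point /=.
rewrite mem_sort mem_cat => /orP[|] /mapP[].
  move=> i; rewrite mem_iota add0n => /= ni -> /=.
  by rewrite subrr hilbert_norm0.
move=> e en -> /=.
(* If no point were near, [find] would return the size of the level, an invalid index; [E_near]
   excludes this. *)
have hase : has (fun q => hilbert_norm (q.2 - e) <= r n) (level n).
  have [e' /mem_net_level[i ni <-] ee'] := E_near en.
  apply/hasP; exists (nth (0%N, 0) (level n) i) => //; exact: mem_nth.
rewrite -has_find; split => //; rewrite hilbert_norm_distC.
exact: (nth_find (0%N, 0) hase).
Qed.

Lemma level_parent_homo n i j :
  (i <= j)%N -> (j < size (level n.+1))%N ->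
  (level_parent n i <= level_parent n j)%N.
Proof.
move=> ij jn; rewrite /level_parent.
apply: (sorted_leq_nth (leT := relpre fst leq)) => //.
- by move=> a b c /=; exact: leq_trans.
- by move=> a /=.
- by apply: sort_sorted => a b /=; exact: leq_total.
- by rewrite inE (leq_ltn_trans ij).
Qed.

(** The required child is the copy of node [i] placed in the first half of [next_level]. *)
Lemma level_lift n i : (i < size (level n))%N ->
  exists j, [/\ (j < size (level n.+1))%N, level_parent n j = i &
    level_point n.+1 j = level_point n i].
Proof.
move=> ni; have : (i, level_point n i) \in level n.+1.
  rewrite [level _]/= mem_sort mem_cat; apply/orP; left; apply/mapP.
  by exists i; rewrite ?mem_iota.
move=> h; exists (index (i, level_point n i) (level n.+1)).
by rewrite index_mem h /level_parent [level_point n.+1 _]/level_point !nth_index.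
Qed.

Lemma holder_map_through_nets (alpha : R) (delta : nat -> R) (M : R) :
  0 < alpha -> alpha <= 1 -> (forall n, 0 < delta n) ->
  (forall n, \sum_(i < n) delta i * (\sum_(j < i.+1) size (E j))%N%:R <= 1) ->
  (forall n, \sum_(i < n) r i <= M) ->
  (forall n, \sum_(i < n) r i * ((delta i.+1 / 2)^-1) `^ alpha <= M) ->
  exists g : R -> H,
    (forall t s, hilbert_norm (g t - g s) <= 2 * M * `|t - s| `^ alpha) /\
    forall n e, e \in E n -> exists t, [/\ 0 <= t, t <= 1 & g t = e].
Proof.
move=> a0 a1 d0 sd sr sh.
have [|||||n|g [gh gp]] := @holder_map_through_tree _ _ H alpha
  (fun n => size (level n)) level_parent level_point r delta M a0 a1 _ _ _ _ _ d0 _ sr sh.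
- by [].
- by move=> n j /level_cases[].
- exact: level_parent_homo.
- by move=> n j /level_cases[].
- exact: level_lift.
- by under eq_bigr do rewrite size_level.
exists g; split => // n e /mem_net_level[i ni <-]; exact: gp.
Qed.

End tree_of_nets.

(** * Choice of the time gaps and geometric series *)

Section geometric_parameters.
Context {R : realType}.
Implicit Types (z s alpha A c : R).

Lemma geometric_sum_le z n : 0 <= z -> z < 1 ->
  \sum_(i < n) z ^+ i <= (1 - z)^-1.
Proof.
move=> z0 z1; have z1' : 0 < 1 - z by rewrite subr_gt0.
rewrite -[leRHS]mul1r ler_pdivlMr // mulrC -opprB mulNr -subrX1 opprB.
by rewrite lerBlDr lerDl exprn_ge0.
Qed.

Lemma powR2_lt1 (x : R) : x < 0 -> 2 `^ x < 1.
Proof.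
by move=> x0; rewrite /powR pnatr_eq0 /= expR_lt1 nmulr_rlt0 // ln_gt0 // ltr1n.
Qed.

Lemma separation_parameters alpha s A c :
  0 < alpha -> s < alpha^-1 -> 0 < A -> 0 <= c ->
  exists (delta : nat -> R) (M : R), [/\ forall n, 0 < delta n,
    forall n, \sum_(i < n) delta i * (A * (2 `^ s) ^+ i) <= 1,
    forall n, \sum_(i < n) c * 2^-1 ^+ i <= M &
    forall n, \sum_(i < n) c * 2^-1 ^+ i * ((delta i.+1 / 2)^-1) `^ alpha <= M].
Proof.
(* The midpoint [b] leaves room on both sides: s < b makes the total time finite, b alpha < 1 makes
   the Hölder constants summable. *)
move=> a0 sa A0 c0; pose b := (s + alpha^-1) / 2.
have sb : s < b by rewrite /b; lra.
have ba : b * alpha < 1.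
  by rewrite -ltr_pdivlMr // mul1r /b; lra.
pose w : R := 2 `^ (- b); pose z := 2^-1 * (w^-1) `^ alpha.
have w0 : 0 < w by rewrite powR_gt0.
have q0 : 0 < 2 `^ s :> R by rewrite powR_gt0.
have qw1 : w * 2 `^ s < 1.
  by rewrite /w -powRD ?powR2_lt1 ?pnatr_eq0 ?implybT //; lra.
have z1 : z < 1.
  rewrite /z /w -powRN opprK -powRrM -(@powR_inv1 _ 2) // -powRD.
    by rewrite powR2_lt1 //; lra.
  by rewrite pnatr_eq0 implybT.
have z0 : 0 <= z by rewrite mulr_ge0 // powR_ge0.
have qw0 : 0 < w * 2 `^ s by rewrite mulr_gt0.
(* [d] normalizes the total time to at most 1. *)
pose d := (1 - w * 2 `^ s) / A.
have d0 : 0 < d by rewrite divr_gt0 // subr_gt0.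
pose e := ((d * w / 2)^-1) `^ alpha.
pose M1 := c * (1 - 2^-1)^-1; pose M2 := c * e * (1 - z)^-1.
have M10 : 0 <= M1 by rewrite mulr_ge0 // invr_ge0; lra.
have M20 : 0 <= M2 by rewrite !mulr_ge0 ?powR_ge0 // invr_ge0 subr_ge0 ltW.
exists (fun n => d * w ^+ n), (M1 + M2); split => n.
- by rewrite mulr_gt0 // exprn_gt0.
- under eq_bigr do rewrite mulrACA -exprMn.
  rewrite -mulr_sumr /d divfK ?gt_eqF // mulrC -ler_pdivlMr ?subr_gt0 // mul1r.
  by apply: geometric_sum_le => //; exact: ltW.
- rewrite -mulr_sumr (le_trans _ (_ : M1 <= _)) ?lerDl // ler_wpM2l //.
  by apply: geometric_sum_le; lra.
- have termE i : c * 2^-1 ^+ i * ((d * w ^+ i.+1 / 2)^-1) `^ alpha =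
      c * e * z ^+ i.
    have -> : (d * w ^+ i.+1 / 2)^-1 = (d * w / 2)^-1 * (w^-1) ^+ i.
      by rewrite exprS exprVn; field; rewrite expf_neq0 ?gt_eqF.
    rewrite powRM ?exprn_ge0 ?invr_ge0 ?(ltW w0) //; last first.
      by rewrite divr_ge0 // mulr_ge0 // ltW.
    rewrite -/e exprMn -[(w^-1) ^+ i]powR_mulrn ?invr_ge0 ?(ltW w0) //.
    rewrite -powRrM mulrC [i%:R * _]mulrC powRrM powR_mulrn ?powR_ge0 //; ring.
  under eq_bigr do rewrite termE.
  rewrite -mulr_sumr (le_trans _ (_ : M2 <= _)) ?lerDr // ler_wpM2l //.
    by rewrite mulr_ge0 // powR_ge0.
  exact: geometric_sum_le.
Qed.

(** The constant K = c q / (q - 1) solves K + c q = K q, so the induction step is an equality. It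
    shows that accumulated net sizes grow at the same rate as single nets. *)
Lemma sum_le_geometric (f : nat -> R) c q : 1 < q -> 0 <= c ->
  (forall n, f n <= c * q ^+ n) ->
  forall n, \sum_(j < n.+1) f j <= c * q / (q - 1) * q ^+ n.
Proof.
move=> q1 c0 fc; have q10 : 0 < q - 1 by rewrite subr_gt0.
elim=> [|n IH].
  rewrite big_ord1 expr0 mulr1 (le_trans (fc _)) //.
  by rewrite expr0 mulr1 -mulrA ler_peMr // ler_pdivlMr // mul1r; lra.
rewrite big_ord_recr /= (le_trans (lerD IH (fc _))) //.
rewrite le_eqVlt; apply/orP; left; apply/eqP; rewrite exprS; field; exact: lt0r_neq0.
Qed.

End geometric_parameters.

(** * From box dimension to finite covers, and closedness of the image *)

Lemma covers_of_upper_box_dim_lt (R : realType) (T : Type) (dist : T -> T -> R)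
    (X : set T) (b : R) : 0 < b -> X !=set0 ->
  (upper_box_dim dist X < b%:E)%E ->
  exists s r0 : R, [/\ 0 < s, s < b, 0 < r0 &
    forall r, 0 < r -> r < r0 ->
      exists2 n, covered_by_balls dist X r n & n%:R <= 2 * r^-1 `^ s].
Proof.
move=> b0 /set0P X0; rewrite /upper_box_dim asboolF; last exact/eqP.
move=> /ereal_inf_lt[_ [V V0 <-]]; set sigma := ereal_sup _ => sb.
have [s [s0 sb' sig_s]] : exists s, [/\ 0 < s, s < b & (sigma <= s%:E)%E].
  case: sigma sb => [sigma|//|_]; last first.
    by exists (b / 2); split; [lra|lra|exact: leNye].
  (* [sigma] may be nonpositive; the maximum with [b / 2] keeps the exponent positive and below
     [b]. *)
  rewrite lte_fin => sb; exists (Num.max sigma (b / 2)).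
  by rewrite lt_max gt_max lee_fin le_max lexx sb; split => //; lra.
have [e /= e0 eV] : nbhs_ball (0 : R) (fun u => 0 < u -> V u) by apply/nbhs_ballP.
(* Radii below 1 make [ln r^-1] positive, so the quotient of logarithms can be cleared. *)
exists s, (Num.min e 1); split => //; first by rewrite lt_min e0 ltr01.
move=> r r0; rewrite lt_min => /andP[re r1].
have L0 : 0 < ln r^-1 by rewrite ln_gt0 // invf_gt1.
have p0 : 0 < r^-1 `^ s by rewrite powR_gt0 // invr_gt0.
have : (lne (covering_number dist X r) * ((ln r^-1)^-1)%:E <= s%:E)%E.
  apply: le_trans sig_s; apply: ereal_sup_ubound; exists r => //.
  by apply: eV => //; rewrite /ball /= sub0r normrN gtr0_norm.
rewrite lee_pdivrMr // => ln_le.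
(* The factor 2 makes the inequality strict, so some actual cover, not just the infimum, satisfies
   the bound. *)
have : (covering_number dist X r < (2 * r^-1 `^ s)%:E)%E.
  case: (covering_number dist X r) ln_le => [c||] //=; last by rewrite ltNyr.
  have [c0 _|c0] := leP c 0; first by rewrite lte_fin (le_lt_trans c0) // mulr_gt0.
  rewrite -EFinM lee_fin lte_fin -ln_powR ler_ln ?posrE // => cp.
  by rewrite (le_lt_trans cp) // ltr_pMl // ltr1n.
move=> /ereal_inf_lt[_ [n nr <-]]; rewrite lte_fin => /ltW n_le.
by exists n.
Qed.

(** The distance from [g t] to [x] is continuous, so it attains its minimum on the compact interval;
    that minimum is below every positive [e], hence 0. *)
Lemma holder_image_attained (R : realType) (k : scalar_kind) (H : hilbertSpace R k)
    (g : R -> H) (C alpha : R) (x : H) : 0 < alpha ->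
  (forall t s, hilbert_norm (g t - g s) <= C * `|t - s| `^ alpha) ->
  (forall e, 0 < e -> exists2 t, t \in `[0, 1] & hilbert_norm (g t - x) <= e) ->
  exists2 t, t \in `[0, 1] & g t = x.
Proof.
move=> a0 gC gx; pose f t := hilbert_norm (g t - x).
have f_cont : continuous f.
  move=> t; apply/cvgrPdist_lt => e e0.
  have C1 : 0 < `|C| + 1 by rewrite ltr_wpDl.
  (* With radius b^(1/alpha) the Hölder bound yields exactly [e]; [|C| + 1] is used since [C] may be
     nonpositive. *)
  pose b := e / (`|C| + 1); have b0 : 0 < b by rewrite divr_gt0.
  apply/nbhs_ballP; exists (b `^ alpha^-1) => /=; first by rewrite powR_gt0.
  move=> s ts.
  apply: (@le_lt_trans _ _ (hilbert_norm (g t - g s))).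
    have := hilbert_dist_triangle (g s) (g t) x.
    have := hilbert_dist_triangle (g t) (g s) x.
    rewrite (hilbert_norm_distC (g s) (g t)) ler_norml /f => h1 h2.
    by apply/andP; split; lra.
  apply: le_lt_trans (gC t s) _.
  apply: (@le_lt_trans _ _ ((`|C| + 1) * `|t - s| `^ alpha)).
    by rewrite ler_wpM2r ?powR_ge0 // (le_trans (ler_norm _)) // lerDl.
  rewrite -ltr_pdivlMl // mulrC -/b.
  have -> : b = (b `^ alpha^-1) `^ alpha.
    by rewrite -powRrM mulVf ?gt_eqF // powRr1 // ltW.
  by apply: gt0_ltr_powR; rewrite ?nnegrE ?normr_ge0 ?powR_ge0 //; exact: ts.
have [t t01 tmin] := EVT_min ler01 (continuous_subspaceT f_cont).
exists t => //; apply/eqP; rewrite -subr_eq0; apply/eqP/hilbert_norm_eq0/eqP.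
rewrite eq_le hilbert_norm_ge0 andbT; apply/ler_addgt0Pl => e e0.
have [u u01 ue] := gx _ e0; rewrite addr0.
exact: le_trans (tmin _ u01) ue.
Qed.

(** * Assembly: nets of [B], the tree, and density *)

Theorem corollary1p16 (R : realType) (k : scalar_kind) (H : hilbertSpace R k)
    (alpha : R) (halpha0 : 0 < alpha) (halpha1 : alpha <= 1)
    (B : set H) (hBc : compact B)
    (hBd : (upper_box_dim (@hilbert_dist R k H) B < (alpha^-1)%:E)%E) :
  exists g : R -> H,
    holder_on (fun s t : R => `|s - t|) (@hilbert_dist R k H) alpha `[0, 1] g /\
    B `<=` g @` `[0, 1].
Proof.
have [->|/set0P B0] := eqVneq B set0.
  exists (fun=> 0); split => //; exists 0 => x z _ _.
  by rewrite mul0r /hilbert_dist subrr normr0 scalar_re0.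
have ai0 : 0 < alpha^-1 by rewrite invr_gt0.
have [s [r0 [s0 sa r00 cover]]] := covers_of_upper_box_dim_lt ai0 B0 hBd.
(* Halving [r0] puts every scale [r1 * 2^-1 ^+ n], including n = 0, strictly below [r0]. *)
pose r1 := r0 / 2; have r10 : 0 < r1 by rewrite divr_gt0.
have scale_gt0 n : 0 < r1 * 2^-1 ^+ n by rewrite mulr_gt0 // exprn_gt0 // invr_gt0.
have /choice[F FP] : forall n, exists F : seq H, [/\ forall e, e \in F -> B e,
    forall x, B x -> exists2 e, e \in F & hilbert_norm (e - x) <= r1 * 2^-1 ^+ n &
    (size F)%:R <= 2 * r1^-1 `^ s * (2 `^ s) ^+ n].
  move=> n; have [||m [c [cB cc]] m_le] := cover (r1 * 2^-1 ^+ n); first by [].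
    rewrite (@le_lt_trans _ _ r1) // /r1; last lra.
    by rewrite ler_piMr ?(ltW r10) // exprn_ile1; lra.
  exists [seq c i | i <- enum 'I_m]; split.
  - by move=> e /mapP[i _ ->].
  - by move=> x /cc[i ix]; exists (c i) => //; rewrite map_f // mem_enum.
  rewrite size_map size_enum_ord (le_trans m_le) // invfM.
  rewrite powRM ?invr_ge0 ?exprn_ge0 ?(ltW r10) // -exprVn invrK.
  have -> : (2 ^+ n) `^ s = (2 `^ s) ^+ n.
    by rewrite -!powR_mulrn ?powR_ge0 // -!powRrM mulrC.
  by rewrite mulrA.
have [x0 Bx0] := B0.
(* The tree needs a single root, so level 0 is one point of [B] rather than a net; [D] bounds its
   distance to the points of the first net. *)
pose E n := if n is 0 then [:: x0] else F n.
pose D := \sum_(e <- F 1%N) hilbert_norm (x0 - e).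
have D0 : 0 <= D by apply: sumr_ge0 => e _; exact: hilbert_norm_ge0.
(* The added 1 accounts for the single point of [E 0]. *)
pose c := 2 * r1^-1 `^ s + 1; pose q : R := 2 `^ s.
have c0 : 0 < c by rewrite ltr_wpDl // mulr_ge0 // powR_ge0.
have q1 : 1 < q.
  by rewrite /q /powR pnatr_eq0 /= expR_gt1 mulr_gt0 // ln_gt0 // ltr1n.
have sizeE n : (size (E n))%:R <= c * q ^+ n.
  case: n => [|n]; first by rewrite /= expr0 mulr1 lerDr mulr_ge0 // powR_ge0.
  have [_ _ h] := FP n.+1; apply: le_trans h _.
  by rewrite ler_wpM2r ?exprn_ge0 ?powR_ge0 // lerDl.
have Cr0 : 0 <= r1 + D by rewrite addr_ge0 // ltW.
have A0 : 0 < c * q / (q - 1) by rewrite divr_gt0 ?subr_gt0 // mulr_gt0 //; lra.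
have [delta [M [d0 d1 M1 M2]]] := separation_parameters halpha0 sa A0 Cr0.
have E_near n e : e \in E n.+1 ->
    exists2 e', e' \in E n & hilbert_norm (e' - e) <= (r1 + D) * 2^-1 ^+ n.
  case: n => [|n] eE.
    exists x0; rewrite ?mem_head // expr0 mulr1 (@le_trans _ _ D) ?lerDr ?(ltW r10) //.
    rewrite /D (big_rem e eE) /= lerDl sumr_ge0 // => *; exact: hilbert_norm_ge0.
  (* Net points lie in [B], so the preceding net has a point close to each of them. *)
  have [_ + _] := FP n.+1; have [inB _ _] := FP n.+2.
  move=> /(_ _ (inB _ eE))[e' e'F le']; exists e' => //; apply: le_trans le' _.
  by rewrite ler_wpM2r ?exprn_ge0 ?invr_ge0 // lerDl.
have rn0 n : 0 <= (r1 + D) * 2^-1 ^+ n by rewrite mulr_ge0 // exprn_ge0 // invr_ge0.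
have [n|g [gC gE]] := @holder_map_through_nets _ _ H E _ x0 erefl rn0 E_near
  alpha delta M halpha0 halpha1 d0 _ M1 M2.
  apply: le_trans (d1 n); apply: ler_sum => i _; rewrite ler_wpM2l ?(ltW (d0 _)) //.
  rewrite natr_sum.
  exact: (sum_le_geometric q1 (ltW c0) sizeE).
exists g; split; first by exists (2 * M) => t u _ _; exact: gC.
move=> x Bx; have [t t01 gt] : exists2 t, t \in `[0, 1] & g t = x.
  apply: (holder_image_attained halpha0 gC) => e e0.
  (* The index is [n.+1] because [E 0] is not a net of [B]. *)
  have [n ne] : exists n, r1 * 2^-1 ^+ n.+1 <= e.
    have ef0 : 0 < e / r1 by rewrite divr_gt0.
    have [m _ /(_ m (leqnn m))] := near_infty_natSinv_expn_lt (PosNum ef0).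
    rewrite /= mul1r -exprVn => h; exists m.
    rewrite -ler_pdivlMl // mulrC (le_trans _ (ltW h)) //.
    by rewrite ler_wiXn2l ?invr_ge0 ?invf_le1 ?ler1n.
  have [_ /(_ _ Bx)[y yF yx] _] := FP n.+1.
  have [t [t0 t1 gty]] := gE n.+1 y yF.
  by exists t; rewrite ?in_itv /= ?t0 // gty (le_trans yx).
by exists t.
Qed.
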